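(* Let $r\in\mathbb{N}$, $m_1,\ldots,m_r\in\mathbb{N}$, $m=\operatorname{lcm}(m_1,\ldots,m_r)$ and $a\in\mathbb{Z}$. Define $$T_a(m_1,\ldots,m_r)=\sum_{\substack{k_1,\ldots,k_{r-1},\ell \ (\mathrm{mod}\ m)\\ \gcd(\ell,m)=1}} c_{m_1}(k_1)\cdots c_{m_{r-1}}(k_{r-1})\,c_{m_r}(k_1+\cdots+k_{r-1}+\ell-a),$$ where $k_1,\ldots,k_{r-1},\ell$ run over complete residue systems modulo $m$ (for $r=1$ the sum is over $\ell$ only). Then $$T_a(m_1,\ldots,m_r)=\begin{cases} m^{r-1}\mu(m)c_m(a), & m_1=\cdots=m_r=m,\\ 0,&\text{otherwise}.\end{cases}$$
   Context: For $n\in\mathbb{N}$ and $k\in\mathbb{Z}$, $c_n(k)=\sum_{1\le j\le n,\ \gcd(j,n)=1}\exp(2\pi i jk/n)$ is the Ramanujan sum (it is periodic in $k$ modulo $n$). $\mu$ is the Möbius function. *)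

(* Defs.v *)
From HB Require Import structures.
From mathcomp Require Import all_boot all_order all_algebra.
From mathcomp Require Import complex reals sequences trigo.

Set Implicit Arguments.
Unset Strict Implicit.
Unset Printing Implicit Defensive.

Import Order.TTheory GRing.Theory Num.Theory.

Local Open Scope ring_scope.
Local Open Scope complex_scope.

(* exp (x + iy) = e^x (cos y + i sin y) *)
Definition cexp (R : realType) (z : R[i]) : R[i] :=
  (expR (complex.Re z))%:C * (cos (complex.Im z) +i* sin (complex.Im z)).

Definition ramanujan_sum (R : realType) (n : nat) (k : int) : R[i] :=
  \sum_(1 <= j < n.+1 | coprime j n)
     cexp (2%:R * (pi : R)%:C * 'i%C * j%:R * k%:~R / n%:R).

(* logn p n is the exponent of p in n, so the test says that n is squarefree;
   size (primes n) is the number of distinct prime divisors of n.  The value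
   at n = 0, which is 1, is irrelevant. *)
Definition mobius (n : nat) : int :=
  if all (fun p => logn p n == 1%N) (primes n)
  then (-1) ^+ size (primes n) else 0.

Definition lcm_family (n : nat) (ms : 'I_n -> nat) : nat :=
  \big[lcmn/1%N]_(i < n) ms i.

(* There are r.+1 moduli, ms i for i < r.+1; the last one is ms ord_max, and
   lift ord_max : 'I_r -> 'I_r.+1 preserves the numerical value of its argument.
   Residues modulo M = lcm are represented by 0, ..., M - 1. *)
Definition Tsum (R : realType) (r : nat) (ms : 'I_r.+1 -> nat) (a : int)
    : R[i] :=
  let M := lcm_family ms in
  \sum_(k : {ffun 'I_r -> 'I_M}) \sum_(l < M | coprime l M)
     (\prod_(i < r) ramanujan_sum R (ms (lift ord_max i)) (k i : nat)%:Z)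
     * ramanujan_sum R (ms ord_max)
         ((\sum_(i < r) (k i : nat)%:Z) + (l : nat)%:Z - a).

(* Main.v *)
(* Let zeta_n = exp (2 pi i / n), so that c_n(k) is the sum of zeta_n^(jk) over
   the j coprime to n.  Expand the last factor of T_a in this way and put
   y = zeta_(m_r)^j: the sums over the k_i separate, and T_a becomes the sum over
   j of y^(-a) (sum_l y^l) prod_i (sum_k c_(m_i)(k) y^k).  The sum over k is
   a sum of geometric sums in zeta_(m_i)^(j') y, hence is M if m_i = m_r (exactly
   one j' then gives the root 1) and 0 otherwise.  When all m_i equal M, the sum
   over l is a sum over all primitive M-th roots of unity, namely mu(M), and the
   remaining sum over j is c_M(-a) = c_M(a). *)
Require Import Defs.
From HB Require Import structures.
From mathcomp Require Import all_boot all_order all_algebra.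
From mathcomp Require Import complex reals sequences trigo.
From mathcomp Require Import exp ring lra.

Local Open Scope ring_scope.
Local Open Scope complex_scope.

Import Order.TTheory GRing.Theory Num.Theory.

(** * Periodic sums, and the sum of all primitive roots of unity as a Möbius value *)

Lemma sum_shift (V : nmodType) (n t : nat) (f : nat -> V) :
  (forall j, f (j + n)%N = f j) ->
  \sum_(0 <= j < n) f (j + t)%N = \sum_(0 <= j < n) f j.
Proof.
move=> fn; elim: t => [|t IHt]; first by under eq_bigr do rewrite addn0.
rewrite -IHt; under eq_bigr do rewrite addnS -addSn.
case: n fn {IHt} => [|n] fn; first by rewrite !big_geq.
rewrite big_nat_recr //= [RHS]big_nat_recl //= addrC; congr (_ + _).
by rewrite addnC fn.
Qed.

(** The range splits into [m] blocks of length [p], and only the first index of each block is a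
    multiple of [p]. *)
Lemma sum_multiples (V : nmodType) (p m : nat) (f : nat -> V) : (0 < p)%N ->
  \sum_(0 <= j < m * p | (p %| j)%N) f j = \sum_(0 <= j < m) f (j * p)%N.
Proof.
case: p => // p _; rewrite big_mkcond big_nat_mul /=; apply: eq_bigr => i _.
rewrite -{1}[(i * p.+1)%N]add0n big_addn mulSn addnK big_nat_recl //=.
rewrite add0n dvdn_mull //.
rewrite big_nat big1 ?addr0 // => j /= ltjp.
by rewrite dvdn_addl ?dvdn_mull // gtnNdvd.
Qed.

Lemma sum_expr_eq0 (F : idomainType) (x : F) (n : nat) :
  x ^+ n = 1 -> x != 1 -> \sum_(k < n) x ^+ k = 0.
Proof.
move=> xn x1; apply/eqP; have /esym/eqP := subrX1 x n.
by rewrite xn subrr mulf_eq0 subr_eq0 (negPf x1).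
Qed.

(** If [p] divides [m], its exponent in the product is at least 2. Otherwise the product gains one
    prime of exponent 1, and the exponents of the other primes do not change. *)
Lemma mobius_mul_prime (p m : nat) : prime p -> (0 < m)%N ->
  mobius (p * m) = if (p %| m)%N then 0 else - mobius m.
Proof.
move=> p_pr m_gt0; have p_gt0 := prime_gt0 p_pr.
have mem_pm q : (q \in primes (p * m)) = (q \in p :: primes m).
  by rewrite primesM // primes_prime // !inE.
rewrite /mobius; case: (boolP (p %| m)%N) => pm.
  case: ifP => // /allP allpm.
  have /allpm : p \in primes (p * m) by rewrite mem_pm mem_head.
  rewrite lognM // logn_prime // eqxx add1n eqSS.
  by rewrite -leqn0 leqNgt logn_gt0 mem_primes p_pr m_gt0 pm.
have perm_pm : perm_eq (primes (p * m)) (p :: primes m).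
  apply: uniq_perm mem_pm; rewrite ?primes_uniq //= primes_uniq andbT.
  by rewrite mem_primes (negPf pm) !andbF.
have logpm : logn p m = 0%N.
  by apply/eqP; rewrite -leqn0 leqNgt logn_gt0 mem_primes (negPf pm) !andbF.
rewrite (perm_all _ perm_pm) (perm_size perm_pm) /=.
rewrite lognM // logn_prime // eqxx logpm /=.
have -> : all (fun q => logn q (p * m) == 1%N) (primes m)
        = all (fun q => logn q m == 1%N) (primes m).
  apply: eq_in_all => q; rewrite mem_primes => /and3P[q_pr _ qm].
  rewrite lognM // logn_prime //; case: (q =P p) => // qp.
  by rewrite qp (negPf pm) in qm.
by case: ifP => _; rewrite ?oppr0 // exprS mulN1r.
Qed.

(* Write n = p m with p prime.  Translation by m preserves coprimality to m and
   multiplies the sum by z ^+ m != 1, so the sum over the j coprime to m is 0;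
   what is left are the multiples of p, which occur only when p does not divide
   m. *)
Lemma sum_prim_root (F : idomainType) (n : nat) (z : F) :
  n.-primitive_root z ->
  \sum_(j < n | coprime j n) z ^+ j = (mobius n)%:~R.
Proof.
elim/ltn_ind: n z => n IHn z zn; have n_gt0 := prim_order_gt0 zn.
have [n1|n_neq1] := eqVneq n 1%N.
  by rewrite n1 big_mkcond big_ord1 coprimen1 expr0.
have n_gt1 : (1 < n)%N by rewrite ltn_neqAle eq_sym n_neq1.
have [p_pr p_dvd] := (pdiv_prime n_gt1, pdiv_dvd n).
set p := pdiv n in p_pr p_dvd; have p_gt0 := prime_gt0 p_pr.
have [m nE] : exists m, n = (m * p)%N by case/dvdnP: p_dvd => m; exists m.
have m_gt0 : (0 < m)%N by move: n_gt0; rewrite nE muln_gt0 => /andP[].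
have ltmn : (m < n)%N by rewrite nE ltn_Pmulr ?prime_gt1.
pose f j := if coprime j m then z ^+ j else 0.
have sumf : \sum_(0 <= j < n) f j = 0.
  have fm j : f (j + m)%N = z ^+ m * f j.
    rewrite /f -coprime_modl modnDr coprime_modl.
    by case: ifP => _; rewrite ?mulr0 // exprD mulrC.
  have fn j : f (j + n)%N = f j.
    rewrite /f -coprime_modl nE mulnC -modnDmr modnMl addn0 coprime_modl.
    by rewrite mulnC -nE exprD (prim_expr_order zn) mulr1.
  have := @sum_shift _ n m f fn; under eq_bigr do rewrite fm.
  rewrite -mulr_sumr => /eqP; rewrite -subr_eq0 -[X in _ - X]mul1r -mulrBl.
  rewrite mulf_eq0 subr_eq0 -(prim_order_dvd zn) gtnNdvd //=.
  by move/eqP.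
have sump : \sum_(j < n | coprime j n) z ^+ j
    = - \sum_(0 <= j < n | (p %| j)%N) (if coprime p m then f j else 0).
  rewrite -(big_mkord (fun j => coprime j n) (fun j => z ^+ j)).
  apply/eqP; rewrite -addr_eq0 -[X in _ == X]sumf; apply/eqP.
  rewrite big_mkcond [X in _ + X]big_mkcond -big_split /=; apply: eq_bigr => j _.
  rewrite /f nE coprimeMr [coprime j p]coprime_sym !(prime_coprime _ p_pr).
  case: (boolP (p %| j)%N) => pj; rewrite ?andbF ?andbT ?add0r ?addr0 //=.
  case: (boolP (p %| m)%N) => //= pm; case: ifP => // jm.
  have : (p %| gcdn j m)%N by rewrite dvdn_gcd pj.
  by rewrite (eqP jm) Euclid_dvd1.
rewrite sump nE sum_multiples // mulnC mobius_mul_prime //.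
rewrite prime_coprime //; case: ifPn => /= pm; first by rewrite big1 ?oppr0.
rewrite mulrNz; congr (- _).
(* At the multiples of [p], the powers of [z] are powers of [z ^+ p], a primitive [m]-th root, so
   the induction hypothesis for [m] applies. *)
have zp : m.-primitive_root (z ^+ p).
  have m_dvd : (m %| n)%N by rewrite nE dvdn_mulr.
  by have := dvdn_prim_root zn m_dvd; rewrite nE mulKn.
rewrite -(IHn m ltmn _ zp) big_mkord [RHS]big_mkcond; apply: eq_bigr => j _.
by rewrite /f coprimeMl (prime_coprime _ p_pr) pm andbT mulnC exprM.
Qed.

(** * Orthogonality of sums over primitive roots *)

Lemma prim_rootV (F : fieldType) (n : nat) (z : F) :
  n.-primitive_root z^-1 = n.-primitive_root z.
Proof.
have V (x : F) : n.-primitive_root x -> n.-primitive_root x^-1.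
  move=> xn; have xVn : x^-1 ^+ n = 1.
    by rewrite exprVn (prim_expr_order xn) invr1.
  have [d xd dn] := prim_order_exists (prim_order_gt0 xn) xVn.
  suff -> : n = d by [].
  apply/eqP; rewrite eqn_dvd dn andbT (prim_order_dvd xn) -invr_eq1 -exprVn.
  by rewrite (prim_expr_order xd).
by apply/idP/idP => /V //; rewrite invrK.
Qed.

(** Since [M] is a common multiple of both orders, each ratio [z ^+ j * y] is an [M]-th root of
    unity, so its geometric sum of length [M] vanishes unless the ratio is 1. *)
Lemma sum_prim_root_orthogonal (F : fieldType) (n m M : nat) (z y : F) :
  n.-primitive_root z -> m.-primitive_root y -> (n %| M)%N -> (m %| M)%N ->
  \sum_(k < M) (\sum_(j < n | coprime j n) (z ^+ k) ^+ j) * y ^+ k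
    = if n == m then M%:R else 0.
Proof.
move=> zn ym nM mM.
have zM j : (z ^+ j) ^+ M = 1.
  by rewrite exprAC (eqP (_ : z ^+ M == 1)) ?expr1n // -(prim_order_dvd zn).
have yM : y ^+ M = 1 by apply/eqP; rewrite -(prim_order_dvd ym).
have -> : \sum_(k < M) (\sum_(j < n | coprime j n) (z ^+ k) ^+ j) * y ^+ k
    = \sum_(j < n | coprime j n) \sum_(k < M) (z ^+ j * y) ^+ k.
  rewrite exchange_big /=; apply: eq_bigr => k _; rewrite mulr_suml.
  by apply: eq_bigr => j _; rewrite exprMn exprAC.
have sum0 (j : 'I_n) : z ^+ j * y != 1 -> \sum_(k < M) (z ^+ j * y) ^+ k = 0.
  by move=> zy; rewrite sum_expr_eq0 // exprMn zM yM mulr1.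
case: eqP => [nm|/eqP nm]; last first.
  apply: big1 => j jn; apply: sum0; apply: contra nm => /eqP zy.
  have zjn : n.-primitive_root (z ^+ j) by rewrite prim_root_exp_coprime.
  rewrite eqn_dvd (prim_order_dvd zjn) (prim_order_dvd ym).
  (* The [m]-th power of [z ^+ j * y = 1] removes [y] and gives [n %| m]; the [n]-th power removes
     [z] and gives [m %| n]. *)
  have := congr1 (fun x => x ^+ n) zy; have := congr1 (fun x => x ^+ m) zy.
  rewrite !exprMn !expr1n (prim_expr_order zjn) (prim_expr_order ym).
  by rewrite mulr1 mul1r => -> ->; rewrite eqxx.
subst m; have y0 : y != 0.
  by rewrite (prim_root_eq0 ym) -lt0n (prim_order_gt0 zn).
(* The only surviving index is the [i] with [z ^+ i = y^-1]; it is coprime to [n] because [y^-1] is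
   again primitive. *)
have [|i yi] := @prim_rootP _ _ _ zn y^-1.
  by rewrite exprVn (prim_expr_order ym) invr1.
have iy : z ^+ i * y = 1 by rewrite -yi mulVf.
have i_cop : coprime i n.
  by rewrite -(prim_root_exp_coprime _ zn) -yi prim_rootV.
rewrite (bigD1 i) //= iy [X in _ + X]big1 ?addr0.
  by under eq_bigr do rewrite expr1n; rewrite sumr_const card_ord.
move=> j /andP[_ ji]; apply: sum0; apply: contra ji => /eqP jy.
have /eqP : z ^+ j = z ^+ i by apply: (mulIf y0); rewrite jy iy.
by rewrite (eq_prim_root_expr zn) !modn_small.
Qed.

(** * The complex exponential and Ramanujan sums *)

Section RamanujanSum.
Variable R : realType.

Definition zeta (n : nat) : R[i] := cexp (2%:R * (pi : R)%:C * 'i%C / n%:R).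

Lemma cexpD (x y : R[i]) : cexp (x + y) = cexp x * cexp y.
Proof.
case: x y => [a b] [c d]; rewrite /cexp /= expRD cosD sinD.
by apply/eqP; rewrite eq_complex /=; apply/andP; split; apply/eqP; ring.
Qed.

Lemma cexp0 : cexp (0 : R[i]) = 1.
Proof. by rewrite /cexp /= expR0 cos0 sin0 mul1r. Qed.

Lemma cexp_neq0 (x : R[i]) : cexp x != 0.
Proof.
apply: contra_eq_neq (cexpD x (- x)) => ->.
by rewrite subrr cexp0 mul0r oner_neq0.
Qed.

Lemma cexpMz (x : R[i]) (k : int) : cexp (x *~ k) = cexp x ^ k.
Proof.
have cexpMn n : cexp (x *+ n) = cexp x ^+ n.
  by elim: n => [|n IHn]; rewrite ?cexp0 // mulrS exprS cexpD IHn.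
case: k => n; first exact: cexpMn.
rewrite NegzE mulrNz -invr_expz -exprnP -cexpMn.
apply: (mulfI (cexp_neq0 (x *+ n.+1))).
by rewrite -cexpD subrr cexp0 divff // cexp_neq0.
Qed.

Lemma zeta_prim (n : nat) : (0 < n)%N -> n.-primitive_root (zeta n).
Proof.
move=> n_gt0; have n0 : n%:R != 0 :> R by rewrite pnatr_eq0 -lt0n.
(* The angle is kept as a double: an order [m < n] would give [1 - 2 sin^2 (pi m / n) = 1], although
   this sine is positive, its argument lying strictly between 0 and pi. *)
have zetaX k : zeta n ^+ k =
    cos (pi * k%:R / n%:R *+ 2) +i* sin (pi * k%:R / n%:R *+ 2).
  rewrite -[_ ^+ k]/(zeta n ^ k%:Z) -cexpMz /cexp.
  have -> : 2 * (pi : R)%:C * 'i%C / n%:R *~ k%:Z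
      = 0 +i* (pi * k%:R / n%:R *+ 2).
    rewrite -pmulrn -[_ *+ k]mulr_natr -!(rmorph_nat (real_complex R)) -fmorphV /=.
    by apply/eqP; rewrite eq_complex /=; apply/andP; split; apply/eqP; ring.
  by rewrite /= expR0 mul1r.
have znn : zeta n ^+ n = 1 by rewrite zetaX mulfK // cos2pi sin2pi.
have [m zm mn] := prim_order_exists n_gt0 znn.
suff nm : n = m by rewrite {1}nm.
apply/eqP; rewrite eqn_leq [X in _ && X]dvdn_leq // andbT leqNgt.
apply/negP => ltmn; have m_gt0 := prim_order_gt0 zm.
have /(congr1 (@complex.Re R)) := prim_expr_order zm.
rewrite zetaX /= cos_mulr2n cos2sin2.
have : 0 < sin (pi * m%:R / n%:R : R).
  apply: sin_gt0_pi; apply/andP; split.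
    by rewrite divr_gt0 ?mulr_gt0 ?pi_gt0 ?ltr0n.
  by rewrite ltr_pdivrMr ?ltr0n // ltr_pM2l ?pi_gt0 // ltr_nat.
by move=> /(fun h => exprn_gt0 2 h); lra.
Qed.

Lemma ramanujan_sumE (n : nat) (k : int) : (0 < n)%N ->
  ramanujan_sum R n k = \sum_(j < n | coprime j n) (zeta n ^ k) ^+ j.
Proof.
move=> n_gt0; have zn := zeta_prim _ n_gt0.
(* The definition sums over 1, ..., n and the ordinals are 0, ..., n - 1; the summand has period
   [n], so a shift by one reconciles them. *)
rewrite /ramanujan_sum big_mkcond big_add1 /=.
pose f j := if coprime j n then (zeta n ^ k) ^+ j else 0.
rewrite [RHS]big_mkcond -(big_mkord predT f) -(@sum_shift _ n 1 f); last first.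
  move=> j; rewrite /f -coprime_modl modnDr coprime_modl exprD.
  rewrite [X in _ * X]exprnP exprzAC -exprnP (prim_expr_order zn).
  by rewrite exp1rz mulr1.
apply: eq_bigr => j _; rewrite addn1 /f; case: ifP => // _.
rewrite [RHS]exprnP exprz_exp /zeta -cexpMz; congr cexp.
rewrite -[RHS]mulrzr intrM -pmulrn -!mulrA; congr (_ * (_ * (_ * _))).
by rewrite mulrA mulrC [k%:~R * _]mulrC.
Qed.

(** Reindex by [j -> - j], where negation in ['I_n.+1] is modular. That this preserves coprimality
    is read off from powers of [zeta]: a root and its inverse are primitive together. *)
Lemma ramanujan_sumN (n : nat) (k : int) : (0 < n)%N ->
  ramanujan_sum R n (- k) = ramanujan_sum R n k.
Proof.
move=> n_gt0; rewrite !ramanujan_sumE //.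
have zn := zeta_prim _ n_gt0; case: n n_gt0 zn => // n _ zn.
rewrite (reindex_inj (inv_inj (@opprK 'I_n.+1))) /=.
have zN (j : 'I_n.+1) : zeta n.+1 ^+ (- j)%R = (zeta n.+1 ^+ j)^-1.
  have z0 : zeta n.+1 != 0 by rewrite (prim_root_eq0 zn).
  apply: (mulIf (expf_neq0 j z0)).
  rewrite mulVf ?expf_neq0 //= (prim_expr_mod zn) -exprD.
  by rewrite subnK ?(ltnW (ltn_ord j)) // (prim_expr_order zn).
apply: eq_big => j.
  by rewrite -!(prim_root_exp_coprime _ zn) zN prim_rootV.
have expAC x (i : nat) : (zeta n.+1 ^ x) ^+ i = (zeta n.+1 ^+ i) ^ x.
  by rewrite exprnP exprzAC.
move=> _; rewrite !expAC zN.
by rewrite exprz_inv opprK.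
Qed.

End RamanujanSum.

(** * Evaluation of [Tsum] *)

Theorem theorem5 (R : realType) (r : nat) (ms : 'I_r.+1 -> nat) (a : int)
    (hms : forall i, (0 < ms i)%N) :
  Tsum R ms a =
    if [forall i, ms i == lcm_family ms]
    then ((lcm_family ms)%:R ^+ r) * (mobius (lcm_family ms))%:~R
           * ramanujan_sum R (lcm_family ms) a
    else 0.
Proof.
rewrite /Tsum; set M := lcm_family ms.
have dvdM i : (ms i %| M)%N by apply: (biglcmn_sup i).
have zp i := zeta_prim R _ (hms i).
pose z := zeta R (ms ord_max); have z0 : z != 0.
  by rewrite (prim_root_eq0 (zp _)) -lt0n.
pose y j := z ^+ j; have y0 j : y j != 0 by rewrite expf_neq0.
have last_term (k : {ffun 'I_r -> 'I_M}) (l : nat) :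
    ramanujan_sum R (ms ord_max) (\sum_(i < r) (k i : nat)%:Z + l%:Z - a)
    = \sum_(j < ms ord_max | coprime j (ms ord_max))
        y j ^ (- a) * y j ^+ l * \prod_(i < r) y j ^+ k i.
  rewrite ramanujan_sumE //; apply: eq_bigr => j _.
  rewrite exprnP exprzAC -exprnP -/z -/(y j) !expfzDr //.
  rewrite mulrC mulrA mulrAC -!mulrA.
  congr (_ * (_ * _)).
  by elim/big_rec2: _ => [|i u v _ <-]; rewrite ?expr0z // expfzDr.
have -> : \sum_(k : {ffun 'I_r -> 'I_M}) \sum_(l < M | coprime l M)
     (\prod_(i < r) ramanujan_sum R (ms (lift ord_max i)) (k i : nat)%:Z)
     * ramanujan_sum R (ms ord_max)
         ((\sum_(i < r) (k i : nat)%:Z) + (l : nat)%:Z - a)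
  = \sum_(j < ms ord_max | coprime j (ms ord_max))
      y j ^ (- a) * (\sum_(l < M | coprime l M) y j ^+ l)
      * \prod_(i < r) (if ms (lift ord_max i) == ms ord_max then M%:R else 0).
  transitivity (\sum_(j < ms ord_max | coprime j (ms ord_max))
      \sum_(k : {ffun 'I_r -> 'I_M}) \sum_(l < M | coprime l M)
      y j ^ (- a) * y j ^+ l * \prod_(i < r)
       (ramanujan_sum R (ms (lift ord_max i)) (k i : nat)%:Z * y j ^+ k i)).
    rewrite [RHS]exchange_big /=; apply: eq_bigr => k _.
    rewrite [RHS]exchange_big /=; apply: eq_bigr => l _.
    rewrite last_term mulr_sumr; apply: eq_bigr => j _.
    by rewrite big_split /= mulrCA.
  apply: eq_bigr => j jn; rewrite exchange_big /= mulr_sumr mulr_suml.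
  apply: eq_bigr => l _; rewrite -mulr_sumr; congr (_ * _).
  (* Distributivity turns the sum over all tuples [k] into a product of single sums; orthogonality
     evaluates each, as [y j] has exact order [ms ord_max]. *)
  rewrite -(bigA_distr_bigA (fun i (k : 'I_M) =>
    ramanujan_sum R (ms (lift ord_max i)) (k : nat)%:Z * y j ^+ k)).
  apply: eq_bigr => i _.
  rewrite -(@sum_prim_root_orthogonal _ _ _ M (zeta R (ms (lift ord_max i)))
    (y j)) //.
    by apply: eq_bigr => k _; rewrite ramanujan_sumE.
  by rewrite prim_root_exp_coprime.
case: ifPn => [/forallP eqM | ].
  have eM i : ms i = M by apply/eqP.
  have prodM : \prod_(i < r)
      (if ms (lift ord_max i) == ms ord_max then M%:R else 0) = M%:R ^+ r :> R[i].
    by under eq_bigr do rewrite !eM eqxx; rewrite prodr_const card_ord.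
  have M_gt0 : (0 < M)%N by rewrite -(eM ord_max).
  have -> : ramanujan_sum R M a
      = \sum_(j < ms ord_max | coprime j (ms ord_max)) y j ^ (- a).
    rewrite -ramanujan_sumN // -[in LHS](eM ord_max) ramanujan_sumE //.
    by apply: eq_bigr => j _; rewrite exprnP exprzAC.
  rewrite mulr_sumr prodM; apply: eq_bigr => j jn.
  have yM : M.-primitive_root (y j).
    by rewrite -(eM ord_max) prim_root_exp_coprime.
  by rewrite (sum_prim_root _ _ _ yM) mulrC [y j ^ _ * _]mulrC mulrA.
rewrite negb_forall => /existsP[i0 i0M].
(* Were all moduli equal to the last one, their lcm would be that common value, contradicting [i0M];
   for [r = 0] this shows that the case cannot occur. *)
have [i /negPf iN] : exists i : 'I_r, ms (lift ord_max i) != ms ord_max.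
  apply/existsP; apply: contraR i0M; rewrite negb_exists => /forallP eqm.
  have eqmax i : ms i = ms ord_max.
    case: (unliftP ord_max i) => [k|] -> //.
    by apply/eqP; move: (eqm k); rewrite negbK.
  rewrite eqn_dvd dvdM /=; apply/dvdn_biglcmP => i _.
  by rewrite !eqmax.
by apply: big1 => j _; rewrite (bigD1 i) //= iN mul0r mulr0.
Qed.
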